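(* Let $m\geq 1$, let $i_1,i_2,\ldots,i_m\geq 2$ and $q\geq 2$ be positive integers. For $0\le l\le m$, indices $1\leq j_1<\cdots<j_l\leq m$, a composition $\eta=(\eta_1,\eta_2,\ldots,\eta_p)\in\mathcal{C}_l$ (where $p$ is the number of parts of $\eta$) and a permutation $\tau\in\mathcal{S}_l$, denote $$\tilde{J}_c(\eta,\tau)=i_{j_{\tau(\eta_1+\cdots+\eta_{c-1}+1)}}+\cdots+i_{j_{\tau(\eta_1+\cdots+\eta_c)}},\qquad c=1,2,\ldots,p.$$ Then $$S_{i_1i_2\cdots i_m,q}=\sum_{l=0}^m(-1)^l\sum_{1\leq j_1<\cdots<j_l\leq m}\frac{\prod_{k=1}^m\zeta(i_k)}{\prod_{k=1}^l\zeta(i_{j_k})}\sum_{\eta\in\mathcal{C}_l}\sum_{\tau\in\mathcal{S}_l}\frac{\zeta\big(\tilde{J}_1(\eta,\tau),\tilde{J}_2(\eta,\tau),\ldots,\tilde{J}_p(\eta,\tau),q\big)}{\eta_1!\,\eta_2!\cdots\eta_p!}.$$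
   Context: Generalized harmonic numbers: $H_n^{(r)}=\sum_{k=1}^n k^{-r}$ for positive integers $n,r$. Euler sum: $S_{i_1i_2\cdots i_m,q}=\sum_{n=1}^{\infty}\frac{H_n^{(i_1)}H_n^{(i_2)}\cdots H_n^{(i_m)}}{n^q}$. Multiple zeta values: for positive integers $s_1,\ldots,s_k$ with $s_1>1$, $\zeta(s_1,s_2,\ldots,s_k)=\sum_{n_1>n_2>\cdots>n_k\geq 1}\frac{1}{n_1^{s_1}n_2^{s_2}\cdots n_k^{s_k}}$; for $k=1$ this is the Riemann zeta value. $\mathcal{S}_l$ is the symmetric group of all permutations of $\{1,\ldots,l\}$. A composition of $l$ is an ordered tuple of positive integers whose elements sum to $l$; $\mathcal{C}_l$ is the set of all compositions of $l$. For $c=1$, the empty sum $\eta_1+\cdots+\eta_{c-1}$ is $0$. Convention for $l=0$: there is exactly one (empty) choice of indices, one (empty, $p=0$) composition and one (empty) permutation, empty products equal $1$, and the corresponding inner sum is $\zeta(q)$. *)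

(* Defs.v *)
From mathcomp Require Import all_boot all_order all_algebra all_fingroup.
From mathcomp Require Import all_classical all_reals all_analysis.

Set Implicit Arguments.
Unset Strict Implicit.
Unset Printing Implicit Defensive.

Import Order.TTheory GRing.Theory Num.Theory.

Local Open Scope classical_set_scope.
Local Open Scope ring_scope.

Definition gen_harmonic (R : realType) (n r : nat) : R :=
  \sum_(1 <= k < n.+1) (k%:R ^- r).

Definition euler_sum (R : realType) (m : nat) (i : 'I_m -> nat) (q : nat) :
    \bar R :=
  (\sum_(1 <= n <oo) ((\prod_(k < m) gen_harmonic R n (i k)) / n%:R ^+ q)%:E)%E.

(* Unordered sum of nonnegative terms: it is +oo when the series diverges,
   which does not happen when the first exponent is > 1 and the others > 0. *)
Definition mzv (R : realType) (s : seq nat) : \bar R :=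
  \esum_(n in [set n : (size s).-tuple nat | sorted gtn n /\ all (ltn 0%N) n])
    (\prod_(k < size s) ((tnth n k)%:R ^- nth 0%N s k))%:E.

Definition zeta (R : realType) (s : seq nat) : R := fine (mzv R s).

Definition compositions (l : nat) : set (seq nat) :=
  [set eta : seq nat | all (ltn 0%N) eta /\ sumn eta = l].

(* The sums over [compositions l] are finitely supported big operators, so they
   are the intended finite sums because of this fact. *)
Lemma finite_compositions (l : nat) : finite_set (compositions l).
Proof.
elim/ltn_ind: l => -[|l] IH.
  by apply: (sub_finite_set _ (finite_set1 [::])) => -[|[|x] s] [].
have fin : finite_set (\bigcup_(x in `I_l.+2)
    [set x :: s | s in if (0 < x)%N then compositions (l.+1 - x) else set0]).
  apply: bigcup_finite => // -[|x] _; apply: finite_image => //=.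
  by apply: IH; rewrite subSS ltnS leq_subr.
apply: sub_finite_set fin => -[|x s] [/= + sl] //.
move=> /andP[x0 s0]; exists x => /=; first by rewrite ltnS -sl leq_addr.
by exists s; rewrite // x0; split => //; rewrite -sl addKn.
Qed.

(* Positions are counted from 0: the c-th block (0 <= c < p) of a composition
   eta of l is made of the t < l with
     eta_0 + ... + eta_(c-1) <= t < eta_0 + ... + eta_c. *)
Definition Jtilde (m l : nat) (i : 'I_m -> nat) (j : l.-tuple 'I_m)
    (eta : seq nat) (tau : 'S_l) (c : nat) : nat :=
  (\sum_(t < l | sumn (take c eta) <= t < sumn (take c.+1 eta))
    i (tnth j (tau t)))%N.

Definition Jtilde_seq (m l : nat) (i : 'I_m -> nat) (j : l.-tuple 'I_m)
    (eta : seq nat) (tau : 'S_l) : seq nat :=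
  [seq Jtilde i j eta tau c | c <- iota 0 (size eta)].

(* Main.v *)
(* With T_k = zeta(i_k) - H_n^(i_k), the tail of zeta(i_k), one expands
   prod_k (zeta(i_k) - T_k) and groups the multi-index sums prod_(k in A) T_k by
   the ordered set partition of A that the order and the ties of the indices
   determine; the division by eta_1! ... eta_p! accounts for the permutations
   inside a block.  Truncating all variables at N turns this into an identity
   between finite sums, valid with arbitrary y_k in place of the zeta(i_k).  It
   is proved by induction on N: splitting off the block of variables equal to
   N + 1 from an injective word w over the indices amounts, after summation over
   w, to replacing y_k by y_k - (N + 1)^(- i_k), because a set B is the support
   of #|B|! injective words.  Then y_k = H_N^(i_k) and N -> oo. *)
Require Import Defs.
From mathcomp Require Import all_boot all_order all_algebra all_fingroup.
From mathcomp Require Import all_classical all_reals all_analysis.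
From mathcomp Require Import ring.

Import Order.TTheory GRing.Theory Num.Theory.
Import numFieldNormedType.Exports.

Local Open Scope classical_set_scope.
Local Open Scope ring_scope.

(** * Compositions and injective words *)

Lemma mem_compositions (l : nat) (eta : seq nat) :
  (eta \in finmap.enum_fset (fset_set (compositions l))) =
  all (ltn 0%N) eta && (sumn eta == l).
Proof.
have E : (eta \in finmap.enum_fset (fset_set (compositions l))) =
  (eta \in compositions l) by rewrite -in_fset_set//; exact: finite_compositions.
rewrite E; apply/idP/andP => [/set_mem[? ->]//|[? /eqP ?]].
exact/mem_set.
Qed.

Lemma compositions0 :
  perm_eq (finmap.enum_fset (fset_set (compositions 0))) [:: [::]].
Proof.
apply: uniq_perm => //.
move=> [|x eta]; rewrite mem_compositions//= inE.
by rewrite addn_eq0; case: x => //= n; rewrite andbF.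
Qed.

Lemma compositionsS (l : nat) :
  perm_eq (finmap.enum_fset (fset_set (compositions l.+1)))
    [seq k.+1 :: eta | k <- iota 0 l.+1,
       eta <- finmap.enum_fset (fset_set (compositions (l - k)))].
Proof.
apply: uniq_perm; first exact: finmap.fset_uniq.
- apply: allpairs_uniq_dep; first exact: iota_uniq.
  + by move=> k _; exact: finmap.fset_uniq.
  + by move=> [k1 e1] [k2 e2] _ _ [/= -> ->].
move=> eta; rewrite mem_compositions; apply/idP/allpairsPdep.
  case: eta => [|[|k] eta]//= /andP[eta0 /eqP[etal]].
  exists k, eta; rewrite -[0%N :: iota 1 l]/(iota 0 l.+1) mem_iota.
  rewrite mem_compositions.
  by rewrite eta0/= add0n -etal addKn eqxx ltnS leq_addr.
move=> [k [e [+ + ->]]]; rewrite mem_iota mem_compositions/= add0n ltnS => kl.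
by move=> /andP[-> /eqP ->]; rewrite addSn subnKC ?eqxx.
Qed.

(** An injective word has at most [#|T|] letters, so bounded sequences enumerate them all. Their
    values are kept as plain sequences so that cutting and concatenating need no change of type. *)
Definition uniq_words (T : finType) : seq (seq T) :=
  [seq w <- map val (enum {: #|T|.-bseq T}) | uniq w].

Lemma uniq_wordsP {T : finType} (w : seq T) :
  reflect (uniq w) (w \in uniq_words T).
Proof.
rewrite mem_filter; apply: (iffP andP) => [[]//|uw]; split => //.
have sw : (size w <= #|T|)%N by rewrite -(card_uniqP uw) max_card.
by apply/mapP; exists (Bseq sw); rewrite // mem_enum.
Qed.

Lemma uniq_words_uniq (T : finType) : uniq (uniq_words T).
Proof. by rewrite filter_uniq// map_inj_uniq ?enum_uniq//; exact: val_inj. Qed.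

(** Cutting [w] at position [k] is a bijection onto the pairs [(u, v)] with [u ++ v] injective; its
    inverse is [(u ++ v, size u)]. *)
Lemma big_uniq_words_cat {T : finType} {V : nmodType} (F : seq T -> seq T -> V) :
  \sum_(w <- uniq_words T) \sum_(k < (size w).+1) F (take k w) (drop k w) =
  \sum_(v <- uniq_words T) \sum_(u <- uniq_words T | uniq (u ++ v)) F u v.
Proof.
pose cuts := [seq (drop k w, take k w) |
  w <- uniq_words T, k <- iota 0 (size w).+1].
pose pairs := [seq (v, u) |
  v <- uniq_words T, u <- [seq u <- uniq_words T | uniq (u ++ v)]].
have -> : \sum_(w <- uniq_words T)
    \sum_(k < (size w).+1) F (take k w) (drop k w) = \sum_(p <- cuts) F p.2 p.1.
  rewrite big_allpairs_dep; apply: eq_bigr => w _.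
  by rewrite -[iota 0 _]/(index_iota 0 (size w).+1) big_mkord.
have -> : \sum_(v <- uniq_words T)
    \sum_(u <- uniq_words T | uniq (u ++ v)) F u v = \sum_(p <- pairs) F p.2 p.1.
  by rewrite big_allpairs_dep; apply: eq_bigr => v _; rewrite big_filter.
apply/perm_big/uniq_perm.
- apply: allpairs_uniq_dep; first exact: uniq_words_uniq.
  + by move=> w _; exact: iota_uniq.
  move=> [w k] [w' k'] /allpairsPdep[w1 [k1 [_ + [-> ->]]]].
  move=> + /allpairsPdep[w2 [k2 [_ + [-> ->]]]] /=.
  rewrite !mem_iota !add0n !ltnS /= => kw1 kw2 [ed et].
  (* The two pieces give back the word, and then the length of the first piece gives back the cut,
     as it is at most [size w]. *)
  have ew := cat_take_drop k1 w1; rewrite et ed cat_take_drop in ew.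
  by subst w2; move/(congr1 size): et; rewrite !size_takel// => ->.
- apply: allpairs_uniq_dep; first exact: uniq_words_uniq.
  + by move=> v _; rewrite filter_uniq// uniq_words_uniq.
  by move=> [v u] [v' u'] _ _ [/= -> ->].
move=> [v u]; apply/allpairsPdep/allpairsPdep.
  move=> [w [k [/uniq_wordsP uw _ [-> ->]]]].
  exists (drop k w), (take k w); split => //.
    by apply/uniq_wordsP; rewrite drop_uniq.
  rewrite mem_filter cat_take_drop uw.
  by apply/uniq_wordsP; rewrite take_uniq.
move=> [v1 [u1 [_ + [-> ->]]]]; rewrite mem_filter => /andP[uw _].
exists (u1 ++ v1), (size u1); split; first exact/uniq_wordsP.
- by rewrite mem_iota size_cat add0n ltnS !leq_addr.
- by rewrite take_size_cat// drop_size_cat.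
Qed.

(** Expanding the product gives a sum over the sets disjoint from [v]. Each such set B is the
    support of #|B|! injective words, which cancels the factorial. *)
Lemma sum_uniq_words_avoiding {T : finType} {R : numFieldType} (x y : T -> R)
    (v : seq T) : uniq v ->
  \sum_(u <- uniq_words T | uniq (u ++ v))
    (\prod_(k <- u) x k) / ((size u)`!)%:R * \prod_(k | k \notin u ++ v) y k =
  \prod_(k | k \notin v) (x k + y k).
Proof.
move=> uv.
(* The values 0 and 1 on [v] extend the product to all of [T] and make the subsets that meet [v]
   contribute 0. *)
pose x' k := if k \in v then 0 else x k; pose y' k := if k \in v then 1 else y k.
have -> : \prod_(k | k \notin v) (x k + y k) = \prod_k (x' k + y' k).
  rewrite big_mkcond; apply: eq_bigr => k _; rewrite /x' /y'.
  by case: (k \in v) => //=; rewrite add0r.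
rewrite bigA_distr (partition_big (fun u : seq T => [set k in u]) xpredT)//=.
apply: eq_bigr => J _.
have [k /andP[kJ kv]|nJv] := pickP (fun k => (k \in J) && (k \in v)).
  rewrite (bigD1 k)//= kJ {1}/x' kv mul0r big1_seq// => u.
  move=> /andP[/andP[+ /eqP uJ] _]; rewrite cat_uniq => /and3P[_ /hasPn/(_ k kv)].
  by rewrite -uJ !inE in kJ * => /negP.
set P := \prod_k _.
(* For [J] disjoint from [v], the words with support [J] are exactly the permutations of
   [enum J]. *)
transitivity (\sum_(u <- permutations (enum J)) P / (#|J| `!)%:R).
  rewrite -big_filter.
  have uwP : perm_eq [seq u <- uniq_words T |
      uniq (u ++ v) && ([set k in u]%SET == J)] (permutations (enum J)).
    apply: uniq_perm.
    - exact/filter_uniq/uniq_words_uniq.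
    - exact: permutations_uniq.
    move=> u; rewrite mem_filter mem_permutations cat_uniq.
    apply/idP/idP => [/andP[/andP[/and3P[uu _ _] /eqP uJ] _]|pJ].
      by apply: uniq_perm; rewrite ?enum_uniq// => k; rewrite mem_enum -uJ inE.
    have uu : uniq u by rewrite (perm_uniq pJ) enum_uniq.
    rewrite uu uv/= !andbT; apply/andP; split; last exact/uniq_wordsP.
    apply/andP; split.
      apply/hasPn => k kv; rewrite /= (perm_mem pJ) mem_enum.
      by apply/negP => kJ; have := nJv k; rewrite kJ kv.
    by apply/eqP/setP => k; rewrite inE (perm_mem pJ) mem_enum.
  rewrite (perm_big _ uwP)/=; apply: eq_big_seq => u.
  rewrite mem_permutations => pJ.
  rewrite (perm_size pJ) -cardE mulrAC; congr (_ / _).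
  rewrite (perm_big _ pJ)/= big_enum/= /P [RHS](bigID (mem J))/=; congr (_ * _).
    apply: eq_bigr => k kJ; rewrite kJ /x'.
    by have := nJv k; rewrite kJ/= => ->.
  rewrite big_mkcond [RHS]big_mkcond; apply: eq_bigr => k _.
  rewrite mem_cat (perm_mem pJ) mem_enum /y'.
  by case: (k \in J) => //=; case: (k \in v).
rewrite big_const_seq count_predT size_permutations ?enum_uniq// -cardE.
rewrite iter_addr_0 -[LHS]mulr_natr mulfVK//.
Qed.

(** * The truncated identity *)

(** The largest variable is k + 1 <= N; truncating the inner sum at [k] makes the next variable
    strictly smaller. *)
Fixpoint trunc_mzv (R : realType) (s : seq nat) (N : nat) : R :=
  if s is a :: s' then \sum_(k < N) k.+1%:R ^- a * trunc_mzv R s' k else 1.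

Lemma trunc_mzvS {R : realType} (a : nat) (s : seq nat) (N : nat) :
  trunc_mzv R (a :: s) N.+1 =
  trunc_mzv R (a :: s) N + N.+1%:R ^- a * trunc_mzv R s N.
Proof. by rewrite /= big_ord_recr. Qed.

Lemma trunc_mzv1 {R : realType} (a N : nat) :
  trunc_mzv R [:: a] N = gen_harmonic R N a.
Proof.
rewrite /gen_harmonic big_add1 big_mkord.
by apply: eq_bigr => k _; rewrite mulr1.
Qed.

(** When [w] lists j_(tau 1), ..., j_(tau l), these are the exponents J~_1, ..., J~_p. *)
Definition blocks {T : Type} (i : T -> nat) (eta : seq nat) (w : seq T) :
    seq nat :=
  map sumn (reshape eta (map i w)).

(* For [w] an ordering [j_(tau 1), ..., j_(tau l)] of the indices, this is
   the N-truncation of the summand of the sum over [tau] in the theorem. *)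
Definition ordering_sum {T : Type} (R : realType) (i : T -> nat) (q N : nat)
    (w : seq T) : R :=
  \sum_(eta <- finmap.enum_fset (fset_set (compositions (size w))))
    trunc_mzv R (rcons (blocks i eta w) q) N / \prod_(e <- eta) (e`!)%:R.

Lemma ordering_sum0 {T : Type} {R : realType} (i : T -> nat) (q : nat)
    (w : seq T) : ordering_sum R i q 0 w = 0.
Proof.
apply: big1 => eta _.
by case: (blocks _ _ _) => [|a s] /=; rewrite big_ord0 mul0r.
Qed.

(* The largest variable N+1 is used by a first block [take k w], or by [q] if
   [w] is empty, or not at all, which is the case k = 0. *)
Lemma ordering_sumS {T : Type} {R : realType} (i : T -> nat) (q N : nat)
    (w : seq T) :
  ordering_sum R i q N.+1 w =
  (if nilp w then N.+1%:R ^- q else 0) +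
  \sum_(k < (size w).+1) (\prod_(a <- take k w) N.+1%:R ^- i a) / (k`!)%:R *
    ordering_sum R i q N (drop k w).
Proof.
rewrite big_ord_recl take0 drop0 big_nil fact0 divr1 mul1r.
rewrite /ordering_sum; case: w => [|a w].
  rewrite big_ord0 addr0 !(perm_big _ compositions0) !big_seq1 !big_nil !divr1.
  by rewrite [rcons _ _]/= trunc_mzvS mulr1 addrC.
rewrite [nilp _]/= add0r [size (a :: w)]/=.
rewrite !(perm_big _ (compositionsS _)) !big_allpairs_dep.
rewrite -[iota 0 _]/(index_iota 0 (size w).+1) !big_mkord -big_split.
apply: eq_bigr => k _; rewrite lift0 size_drop [size (a :: w)]/= subSS.
rewrite big_distrr -big_split; apply: eq_bigr => eta _.
rewrite big_cons.
have -> : blocks i (k.+1 :: eta) (a :: w) =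
    sumn (map i (take k.+1 (a :: w))) :: blocks i eta (drop k.+1 (a :: w)).
  by rewrite /blocks /= map_take map_drop.
rewrite rcons_cons trunc_mzvS mulrDl; congr (_ + _).
have -> u : N.+1%:R ^- sumn (map i u) = \prod_(b <- u) N.+1%:R ^- i b :> R.
  elim: u => [|b u IH]; first by rewrite big_nil/= expr0 invr1.
  by rewrite big_cons/= exprD invfM IH.
by rewrite invfM mulrACA.
Qed.

(** On the right, the variable with exponent [q] is n + 1, and [y k] loses the terms of zeta(i_k)
    with index from n + 2 to N. The function [y] is general because the induction step changes
    it. *)
Lemma sum_uniq_words_ordering_sum {T : finType} {R : realType} (i : T -> nat)
    (q N : nat) (y : T -> R) :
  \sum_(w <- uniq_words T) (-1) ^+ size w *
    (\prod_(k | k \notin w) y k) * ordering_sum R i q N w =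
  \sum_(n < N) n.+1%:R ^- q *
    \prod_k (y k - (gen_harmonic R N (i k) - gen_harmonic R n.+1 (i k))).
Proof.
elim: N y => [|N IH] y.
  by rewrite big_ord0 big1// => w _; rewrite ordering_sum0 mulr0.
pose x k : R := N.+1%:R ^- i k.
have harmS k : gen_harmonic R N.+1 (i k) = gen_harmonic R N (i k) + x k.
  by rewrite -!trunc_mzv1 trunc_mzvS mulr1.
rewrite big_ord_recr/=.
under [X in _ = _ + _ * X]eq_bigr do rewrite subrr subr0.
under eq_bigr do rewrite ordering_sumS mulrDr.
rewrite big_split/= addrC; congr (_ + _).
  (* Since H_(N+1) = H_N + x, passing from N + 1 to N amounts to replacing y by y - x in the
     induction hypothesis. *)
  transitivity (\sum_(n < N) n.+1%:R ^- q *
    \prod_k (- x k + y k -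
      (gen_harmonic R N (i k) - gen_harmonic R n.+1 (i k)))).
    rewrite -IH.
    (* The sign of w = u ++ v is shared out: the part from [u] turns each x into -x, the part from
       [v] stays for the induction hypothesis. *)
    pose F u v := ((\prod_(k <- u) - x k) / ((size u)`!)%:R *
      \prod_(k | k \notin u ++ v) y k) *
      ((-1) ^+ size v * ordering_sum R i q N v).
    transitivity (\sum_(w <- uniq_words T)
        \sum_(k < (size w).+1) F (take k w) (drop k w)).
      apply: eq_bigr => w _; rewrite big_distrr/=; apply: eq_bigr => k _.
      have kw : (k <= size w)%N by rewrite -ltnS.
      rewrite /F cat_take_drop size_takel//.
      have -> : \prod_(k <- take k w) - x k =
          (-1) ^+ k * \prod_(k <- take k w) x k.
        rewrite -{2}(size_takel kw); elim: (take k w) => [|b u IHu].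
          by rewrite !big_nil mulr1.
        by rewrite !big_cons IHu/= exprS; ring.
      rewrite -[in (-1) ^+ size w](cat_take_drop k w) size_cat size_takel// exprD.
      rewrite /x; ring.
    rewrite big_uniq_words_cat; apply: eq_big_seq => v /uniq_wordsP uv.
    by rewrite -mulr_suml sum_uniq_words_avoiding//; ring.
  apply: eq_bigr => n _; congr (_ * _); apply: eq_bigr => k _.
  by rewrite harmS; ring.
(* What remains is the term n = N, where the variable of [q] is N + 1; only the empty word produces
   it. *)
rewrite (bigD1_seq [::])/=; last 2 first.
- exact/uniq_wordsP.
- exact: uniq_words_uniq.
rewrite [X in _ + X]big1 => [|w]; last by case: w => //= *; rewrite mulr0.
by rewrite addr0 mul1r mulrC.
Qed.

(** * Convergence of truncated multiple zeta values *)

Lemma trunc_mzv_ge0 {R : realType} (s : seq nat) (N : nat) :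
  0 <= trunc_mzv R s N.
Proof.
elim: s N => [|a s IH] N; first exact: ler01.
by apply: sumr_ge0 => k _; rewrite mulr_ge0// invr_ge0 exprn_ge0.
Qed.

Lemma trunc_mzv_nondecreasing {R : realType} (s : seq nat) :
  {homo trunc_mzv R s : N M / (N <= M)%N >-> N <= M}.
Proof.
apply: (homo_leq le_refl le_trans) => N.
by case: s => [//|a s]; rewrite trunc_mzvS lerDl mulr_ge0 ?trunc_mzv_ge0.
Qed.

Lemma sum_inv_exp_le2 {R : realType} (a N : nat) : (2 <= a)%N ->
  \sum_(k < N) (k.+1%:R : R) ^- a <= 2.
Proof.
move=> a2; case: N => [|N]; first by rewrite big_ord0.
(* The sharper bound 2 - 1/N goes through the induction, by 1/(x+1)^2 <= 1/x - 1/(x+1). *)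
apply: (@le_trans _ _ (2 - N.+1%:R^-1)); last by rewrite gerBl invr_ge0.
elim: N => [|N IH].
  by rewrite big_ord1 expr1n invr1 lerBrDr.
rewrite big_ord_recr/=.
have le2 : N.+2%:R ^- a <= N.+2%:R ^- 2 :> R.
  by rewrite lef_pV2 ?posrE ?exprn_gt0// ler_weXn2l// ler1n.
apply: (le_trans (lerD IH le2)).
have N0 : 0 < N.+1%:R :> R by rewrite ltr0n.
have -> : N.+2%:R = N.+1%:R + 1 :> R by rewrite -natr1.
move: (N.+1%:R : R) N0 => x x0.
have -> : 2 - (x + 1)^-1 = 2 - x^-1 + (x + 1) ^- 2 + x^-1 * (x + 1) ^- 2.
  by field; rewrite !lt0r_neq0 ?addr_gt0.
by rewrite lerDl mulr_ge0// invr_ge0 ?exprn_ge0 ?addr_ge0 ?ltW.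
Qed.

Lemma trunc_mzv_le {R : realType} (s : seq nat) (N : nat) :
  all (leq 2) s -> trunc_mzv R s N <= 2 ^+ size s.
Proof.
elim: s N => [|a s IH] N //= /andP[a2 s2].
rewrite exprS; apply: (@le_trans _ _ (\sum_(k < N) k.+1%:R ^- a * 2 ^+ size s)).
  by apply: ler_sum => k _; rewrite ler_wpM2l ?IH// invr_ge0 exprn_ge0.
by rewrite -mulr_suml ler_wpM2r ?exprn_ge0// sum_inv_exp_le2.
Qed.

(** These are the index tuples of [trunc_mzv], in the order of its nested sums; they link it to the
    unordered sum [mzv]. *)
Fixpoint decreasing_seqs (p N : nat) : seq (seq nat) :=
  if p is p'.+1 then
    [seq k.+1 :: u | k <- index_iota 0 N, u <- decreasing_seqs p' k]
  else [:: [::]].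

Lemma mem_decreasing_seqs (p N : nat) (u : seq nat) :
  (u \in decreasing_seqs p N) =
  [&& size u == p, sorted gtn u, all (ltn 0%N) u & all (geq N) u].
Proof.
elim: p N u => [|p IH] N u; first by rewrite inE; case: u.
have gtn_tr : transitive gtn by move=> y x z /= xy yz; exact: ltn_trans yz xy.
apply/allpairsPdep/idP => [[k [v [+ + ->]]]|].
  rewrite mem_index_iota IH => /andP[_ kN] /and4P[/eqP <- vs v0 vk].
  rewrite /= eqxx (path_sortedE gtn_tr) vs v0 kN !andbT/=; apply/andP; split.
    exact: vk.
  by apply: sub_all vk => x /= xk; rewrite (leq_trans xk)// ltnW.
case: u => [|[|k] v]//=; first by rewrite !andbF.
rewrite (path_sortedE gtn_tr) => /and4P[vp /andP[vk vs] v0 /andP[kN vN]].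
exists k, v; rewrite mem_index_iota IH kN vs v0; split => //.
by rewrite -eqSS vp.
Qed.

Lemma decreasing_seqs_uniq (p N : nat) : uniq (decreasing_seqs p N).
Proof.
elim: p N => [|p IH] N //=.
apply: allpairs_uniq_dep => [|k _|[k u] [k' u'] _ _ [/= -> ->]//].
  exact: iota_uniq.
exact: IH.
Qed.

Lemma trunc_mzvE {R : realType} (s : seq nat) (N : nat) :
  trunc_mzv R s N = \sum_(u <- decreasing_seqs (size s) N)
    \prod_(k < size s) ((nth 0%N u k)%:R ^- nth 0%N s k).
Proof.
elim: s N => [|a s IH] N; first by rewrite big_seq1 big_ord0.
rewrite [decreasing_seqs _ _]/= big_allpairs_dep.
rewrite big_mkord/=.
apply: eq_bigr => k _; rewrite IH big_distrr; apply: eq_bigr => u _.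
by rewrite big_ord_recl.
Qed.

(** The terms are nonnegative, each truncation is a finite subsum, and every finite set of index
    tuples lies below some truncation. *)
Lemma mzvE {R : realType} (s : seq nat) :
  mzv R s = ereal_sup (range (fun N => (trunc_mzv R s N)%:E)).
Proof.
pose f (n : (size s).-tuple nat) : \bar R :=
  (\prod_(k < size s) ((tnth n k)%:R ^- nth 0%N s k))%:E.
have f0 n : (0 <= f n)%E.
  by rewrite lee_fin prodr_ge0// => k _; rewrite invr_ge0 exprn_ge0.
pose D N := [set n : (size s).-tuple nat | val n \in decreasing_seqs (size s) N].
have finD N : finite_set (D N).
  apply: (@finite_preimage _ _ [set` decreasing_seqs (size s) N]) => //.
  by move=> x y _ _; exact: val_inj.
have sumD N : (\sum_(n \in D N) f n)%E = (trunc_mzv R s N)%:E.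
  rewrite trunc_mzvE (fsbig_seq _ _ (decreasing_seqs_uniq _ _)) fsumEFin//.
  congr (_%:E); rewrite (reindex_fsbig val (D N)).
    apply: eq_fsbigr => n _; apply: eq_bigr => k _.
    by rewrite (tnth_nth 0%N).
  split => //; first by move=> x y _ _; exact: val_inj.
  move=> u /= uD; have := uD; rewrite mem_decreasing_seqs => /andP[su _].
  by exists (Tuple su).
apply/eqP; rewrite eq_le; apply/andP; split.
  apply: ge_ereal_sup => _ [A [finA AD] <-].
  have [r rA] := (finite_seqP _).1 finA.
  (* Every entry of a tuple is at most the sum of its entries. *)
  pose N := (\max_(n <- r) sumn (val n))%N.
  apply: (@le_trans _ _ (trunc_mzv R s N)%:E); last exact: ereal_sup_ubound.
  rewrite -sumD; apply: lee_fsum_nneg_subset => // n; last by move=> _; exact: f0.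
  move=> /set_mem An; apply/mem_set; rewrite /D/= mem_decreasing_seqs.
  have [-> n0] := AD _ An; rewrite size_tuple eqxx n0/=.
  have nN : (sumn n <= N)%N.
    by apply: (leq_bigmax_seq n) => //; move: An; rewrite rA.
  apply/allP => x xn /=; apply: leq_trans nN.
  by rewrite sumnE (big_rem x)//= leq_addr.
apply: ge_ereal_sup => _ [N _ <-]; rewrite -sumD; apply: ereal_sup_ubound.
exists (D N) => //; split => // n; rewrite /D/= mem_decreasing_seqs.
by move=> /and4P[].
Qed.

Lemma trunc_mzv_cvg {R : realType} (s : seq nat) : all (leq 2) s ->
  trunc_mzv R s N @[N --> \oo] --> zeta R s.
Proof.
move=> s2.
have h : {homo (fun N => (trunc_mzv R s N)%:E) : N M / (N <= M)%N >-> (N <= M)%E}.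
  by move=> N M NM; rewrite lee_fin trunc_mzv_nondecreasing.
have := ereal_nondecreasing_cvgn h; rewrite -mzvE.
(* Finiteness matters because [zeta] would take the default value 0 at +oo. *)
have mfin : mzv R s \is a fin_num.
  rewrite mzvE; apply/fin_numPlt; apply/andP; split.
    apply: (@lt_le_trans _ _ (trunc_mzv R s 0)%:E); first exact: ltNyr.
    exact: ereal_sup_ubound.
  apply: (@le_lt_trans _ _ (2 ^+ size s)%:E); last exact: ltry.
  by apply: ge_ereal_sup => _ [N _ <-]; rewrite lee_fin trunc_mzv_le.
by rewrite -(fineK mfin) => /fine_cvgP[].
Qed.

(** The truncation at 1 already equals 1. Positivity makes the quotients of zeta values in the
    theorem genuine. *)
Lemma zeta_gt0 {R : realType} (a : nat) : (2 <= a)%N -> 0 < zeta R [:: a].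
Proof.
move=> a2; have c : trunc_mzv R [:: a] N @[N --> \oo] --> zeta R [:: a].
  by apply: trunc_mzv_cvg; rewrite /= a2.
apply: (@lt_le_trans _ _ 1) => //; rewrite -(cvg_lim _ c)//.
apply: limr_ge; first by apply/cvg_ex; exists (zeta R [:: a]).
exists 1%N => // N /= N1.
apply: le_trans _ (trunc_mzv_nondecreasing [:: a] _ _ N1).
by rewrite /= big_ord1 expr1n invr1 mul1r.
Qed.

(** * Indexing by sorted tuples and permutations *)

Lemma sumn_take_drop (u : seq nat) (a n : nat) :
  sumn (take n (drop a u)) =
  (\sum_(t < size u | a <= t < a + n) nth 0 u t)%N.
Proof.
elim: u a n => [|x u IH] a n; first by rewrite big_ord0.
rewrite big_mkcond big_ord_recl/=.
case: a => [|a] /=; last by rewrite add0n IH [LHS]big_mkcond.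
case: n => [|n]; first by rewrite big1.
by rewrite /= -[u in LHS]drop0 IH [in LHS]big_mkcond.
Qed.

(** The positions selected by [Jtilde] for [c] form the c-th slice cut out by [reshape]. *)
Lemma Jtilde_seqE (m l : nat) (i : 'I_m -> nat) (j : l.-tuple 'I_m)
    (eta : seq nat) (tau : 'S_l) :
  Jtilde_seq i j eta tau = blocks i eta [tuple tnth j (tau t) | t < l].
Proof.
apply: (@eq_from_nth _ 0%N) => [|c]; rewrite size_map size_iota.
  by rewrite size_map size_reshape.
move=> ceta; rewrite (nth_map 0%N) ?size_iota// nth_iota// add0n.
rewrite (nth_map [::]) ?size_reshape// nth_reshape sumn_take_drop.
rewrite size_map size_tuple /Jtilde (take_nth 0%N)// sumn_rcons.
apply: eq_bigr => t _.
rewrite (nth_map (tnth j (tau t))) ?size_tuple//.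
by rewrite -tnth_nth tnth_mktuple.
Qed.

Lemma blocks_ge2 {T : Type} (i : T -> nat) (eta : seq nat) (w : seq T) :
  (forall k, 2 <= i k)%N -> all (ltn 0%N) eta -> (sumn eta <= size w)%N ->
  all (leq 2) (blocks i eta w).
Proof.
move=> i2; elim: eta w => [//|e eta IH] w /= /andP[e0 eta0] etaw.
rewrite -map_drop -/(blocks i eta (drop e w)) IH//; last first.
  by rewrite size_drop leq_subRL// (leq_trans (leq_addr _ _) etaw).
case: e w e0 etaw => [//|e] [//|a w] _ _ /=.
by rewrite andbT (leq_trans (i2 a))// leq_addr.
Qed.

(** An injective word is in exactly one way a rearrangement of a strictly increasing tuple, namely
    of its sorted form. *)
Lemma big_sorted_tuple_perm {m l : nat} {V : nmodType} (F : seq 'I_m -> V) :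
  \sum_(j : l.-tuple 'I_m | sorted ltn (map (@nat_of_ord m) j))
    \sum_(tau : 'S_l) F [tuple tnth j (tau t) | t < l] =
  \sum_(w <- uniq_words 'I_m | size w == l) F w.
Proof.
pose sorted_tuples :=
  enum (fun j : l.-tuple 'I_m => sorted ltn (map (@nat_of_ord m) j)).
pose reordered := [seq val [tuple tnth j (tau t) | t < l] |
  j : l.-tuple 'I_m <- sorted_tuples, tau : 'S_l <- enum {: 'S_l}].
have tuple_perm (j : l.-tuple 'I_m) (tau : 'S_l) :
    perm_eq [tuple tnth j (tau t) | t < l] j.
  by apply/tuple_permP; exists tau.
have sorted_tuple_uniq (j : l.-tuple 'I_m) : j \in sorted_tuples -> uniq j.
  rewrite mem_enum => sj; apply: (@map_uniq _ _ (@nat_of_ord m)).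
  exact: (sorted_uniq ltn_trans ltnn).
transitivity (\sum_(w <- reordered) F w).
  rewrite big_allpairs_dep big_enum; apply: eq_bigr => j _.
  by rewrite big_enum.
rewrite -[RHS]big_filter; apply/perm_big/uniq_perm.
- apply: allpairs_uniq_dep => [|j _|]; [exact: enum_uniq|exact: enum_uniq|].
  move=> [j tau] [j' tau'] /allpairsPdep[j1 [tau1 [+ _ [-> ->]]]].
  move=> + /allpairsPdep[j2 [tau2 [+ _ [-> ->]]]] => j1s j2s eval.
  have e : [tuple tnth j1 (tau1 t) | t < l] = [tuple tnth j2 (tau2 t) | t < l].
    exact: val_inj eval.
  have e12 : perm_eq j1 j2.
    by apply: perm_trans (tuple_perm j2 tau2); rewrite -e perm_sym.
  have j12 : j1 = j2.
    apply/val_inj/(inj_map (@ord_inj m)).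
    move: j1s j2s; rewrite !mem_enum => s1 s2.
    apply: (irr_sorted_eq ltn_trans ltnn) => //; exact/perm_mem/perm_map.
  subst j2; congr existT; apply/permP => t.
  have := congr1 (fun w => tnth w t) e.
  by rewrite !tnth_mktuple => /(tuple_uniqP _ (sorted_tuple_uniq _ j1s)).
- exact/filter_uniq/uniq_words_uniq.
move=> w; apply/allpairsPdep/idP.
  move=> [j [tau [js _ ->]]]; rewrite mem_filter size_tuple eqxx/=.
  by apply/uniq_wordsP; rewrite (perm_uniq (tuple_perm j tau)) sorted_tuple_uniq.
rewrite mem_filter => /andP[wl /uniq_wordsP uw].
pose s := sort (fun a b : 'I_m => (a <= b)%N) w.
have sl : size s == l by rewrite size_sort.
have /tuple_permP[tau wE] : perm_eq w (Tuple sl) by rewrite perm_sym perm_sort.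
exists (Tuple sl), tau; split => //; last by rewrite mem_enum.
rewrite mem_enum; change (sorted ltn (map (@nat_of_ord m) s)).
rewrite ltn_sorted_uniq_leq map_inj_uniq; last exact: ord_inj.
rewrite sort_uniq uw/= sorted_map; apply: sort_sorted => a b.
exact: leq_total.
Qed.

Lemma prod_ratio_notin {T : finType} {R : fieldType} (z : T -> R) (w : seq T) :
  uniq w -> (forall k, z k != 0) ->
  (\prod_k z k) / (\prod_(k <- w) z k) = \prod_(k | k \notin w) z k.
Proof.
move=> uw z0; rewrite (bigID (mem w))/= -big_uniq//= mulrAC mulfV ?mul1r//.
by rewrite prodf_seq_neq0; apply/allP => k _; exact: z0.
Qed.

(** * Passage to the limit *)

Theorem theorem2p2 (R : realType) (m : nat) (i : 'I_m -> nat) (q : nat)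
    (hm : (1 <= m)%N) (hi : forall k : 'I_m, (2 <= i k)%N) (hq : (2 <= q)%N) :
  euler_sum R i q =
  (\sum_(0 <= l < m.+1) (-1) ^+ l *
     \sum_(j : l.-tuple 'I_m | sorted ltn (map (@nat_of_ord m) j))
       ((\prod_(k < m) zeta R [:: i k]) /
          (\prod_(k < l) zeta R [:: i (tnth j k)]) *
        \sum_(eta \in compositions l) \sum_(tau : 'S_l)
          (zeta R (rcons (Jtilde_seq i j eta tau) q) /
           \prod_(e <- eta) (e`!)%:R)))%:E.
Proof.
pose z k := zeta R [:: i k].
have z0 k : z k != 0 by rewrite lt0r_neq0// zeta_gt0.
(* [G w] is the limit of the summand of [w] in the truncated identity with y_k = H_N^(i_k). *)
pose G w := (-1) ^+ size w * (\prod_(k | k \notin w) z k) *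
  \sum_(eta <- finmap.enum_fset (fset_set (compositions (size w))))
    zeta R (rcons (blocks i eta w) q) / \prod_(e <- eta) (e`!)%:R.
transitivity (\sum_(w <- uniq_words 'I_m) G w)%:E; last first.
  congr (_%:E); rewrite big_mkord.
  transitivity (\sum_(l < m.+1) \sum_(w <- uniq_words 'I_m | size w == l) G w).
    rewrite (exchange_big_dep xpredT)//=.
    apply: eq_big_seq => w /uniq_wordsP uw.
    have wm : (size w < m.+1)%N.
      by rewrite ltnS -(card_uniqP uw) (leq_trans (max_card _))// card_ord.
    by rewrite (big_pred1 (Ordinal wm)).
  apply: eq_bigr => l _; rewrite -big_sorted_tuple_perm [RHS]big_distrr.
  apply: eq_bigr => j js.
  have uj : uniq j.
    apply: (@map_uniq _ _ (@nat_of_ord m)).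
    exact: (sorted_uniq ltn_trans ltnn).
  (* With [tau] outermost, each pair of [j] and [tau] stands for a single word. *)
  rewrite (fsbig_finite _ _ (finite_compositions l)) exchange_big [RHS]mulrA.
  rewrite [RHS]big_distrr; apply: eq_bigr => tau _.
  pose w := [tuple tnth j (tau t) | t < l]; rewrite -/w.
  have wj : perm_eq w j by apply/tuple_permP; exists tau.
  have -> : G w = (-1) ^+ l * (\prod_(k | k \notin w) z k) *
      \sum_(eta <- finmap.enum_fset (fset_set (compositions l)))
        zeta R (rcons (blocks i eta w) q) / \prod_(e <- eta) (e`!)%:R.
    by rewrite /G size_tuple.
  congr (_ * _ * _).
    rewrite -prod_ratio_notin ?(perm_uniq wj)//.
    by rewrite (perm_big _ wj) big_tuple.
  by apply: eq_bigr => eta _; rewrite Jtilde_seqE.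
pose S N : R := \sum_(n < N) n.+1%:R ^- q * \prod_k gen_harmonic R n.+1 (i k).
(* The choice y_k = H_N leaves H_N - (H_N - H_(n+1)) = H_(n+1) in each factor. *)
have SE N : S N = \sum_(w <- uniq_words 'I_m) (-1) ^+ size w *
    (\prod_(k | k \notin w) gen_harmonic R N (i k)) * ordering_sum R i q N w.
  rewrite sum_uniq_words_ordering_sum; apply: eq_bigr => n _; congr (_ * _).
  by apply: eq_bigr => k _; rewrite subKr.
have Scvg : S N @[N --> \oo] --> \sum_(w <- uniq_words 'I_m) G w.
  rewrite (funext SE); apply: cvg_big => [|w _]; first exact: add_continuous.
  apply: cvgM.
    apply: cvgM; first exact: cvg_cst.
    apply: cvg_big => [|k _]; first exact: mul_continuous.
    under eq_fun do rewrite -trunc_mzv1.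
    by apply: trunc_mzv_cvg; rewrite /= hi.
  (* Membership of [eta] is kept: positive parts are what makes every block exponent at least 2. *)
  rewrite [X in _ --> X]big_seq.
  under eq_fun do rewrite /ordering_sum big_seq.
  apply: cvg_big => [|eta]; first exact: add_continuous.
  rewrite mem_compositions => /andP[eta0 /eqP etaw].
  apply: cvgM; last exact: cvg_cst.
  by apply: trunc_mzv_cvg; rewrite all_rcons hq/= blocks_ge2// etaw.
have EScvg : (S N)%:E @[N --> \oo] --> (\sum_(w <- uniq_words 'I_m) G w)%:E.
  by apply/fine_cvgP; split; [exact: nearW|exact: Scvg].
(* The series starts at n = 1, so its partial sum below N + 1 is [S N]. *)
apply/cvg_lim => //; rewrite -cvg_shiftS/=.
under eq_fun => N.
  rewrite big_add1/= big_mkord sumEFin.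
  have -> : \sum_(n < N)
      (\prod_(k < m) gen_harmonic R n.+1 (i k)) / n.+1%:R ^+ q = S N.
    by apply: eq_bigr => n _; rewrite mulrC.
  over.
exact: EScvg.
Qed.
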